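(* Let $S,T$ be as in the context and let $n,k\geq 1$ be natural numbers. If $\mathrm{Pr}_T(x)$ is a $\Sigma_1$ provability predicate of $T$ satisfying $\mathbf{C}$ and $\mathbf{D3}^n_{n+k}$, then $\mathrm{Pr}_T(x)$ does not satisfy $\mathbf{Ros}$.
   Context: $\mathcal{L}_A=\{0,\mathsf{s},+,\times,\leq\}$ is the language of first-order arithmetic, and ''formula'' means $\mathcal{L}_A$-formula; $\ulcorner\varphi\urcorner$ is the numeral of the Gödel number of $\varphi$. $S$ and $T$ are consistent c.e. extensions of Peano Arithmetic $\mathsf{PA}$ in the language $\mathcal{L}_A$ such that $T$ is stronger than $S$ (every theorem of $S$ is a theorem of $T$; $S=T$ is allowed). A formula $\mathrm{Pr}_T(x)$ is a provability predicate of $T$ if for every formula $\varphi$: $T\vdash\varphi$ if and only if $S\vdash\mathrm{Pr}_T(\ulcorner\varphi\urcorner)$. A $\Sigma_1$ provability predicate is one that is a $\Sigma_1$ formula. Define $\mathrm{Pr}_T^0(\ulcorner\varphi\urcorner)$ to be $\varphi$ and $\mathrm{Pr}_T^{i+1}(\ulcorner\varphi\urcorner)$ to be $\mathrm{Pr}_T(\ulcorner\mathrm{Pr}_T^i(\ulcorner\varphi\urcorner)\urcorner)$. Conditions on $\mathrm{Pr}_T(x)$: - $\mathbf{C}$: $S\vdash\mathrm{Pr}_T(\ulcorner\varphi\urcorner)\land\mathrm{Pr}_T(\ulcorner\psi\urcorner)\to\mathrm{Pr}_T(\ulcorner\varphi\land\psi\urcorner)$ for all formulas $\varphi,\psi$.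 - $\mathbf{D3}^n_m$: $S\vdash\mathrm{Pr}_T^n(\ulcorner\varphi\urcorner)\to\mathrm{Pr}_T^m(\ulcorner\varphi\urcorner)$ for every formula $\varphi$. - $\mathbf{Ros}$: for every formula $\varphi$, if $T\vdash\neg\varphi$, then $T\vdash\neg\,\mathrm{Pr}_T(\ulcorner\varphi\urcorner)$. *)

(* Defs.v *)
From Stdlib Require Import Arith List Cantor.
Import ListNotations.

(** * Syntax: the language 0, s, +, *, <= with equality, in de Bruijn form *)

Inductive term : Type :=
  | Var (i : nat)
  | Zero
  | Succ (t : term)
  | Plus (t u : term)
  | Times (t u : term).

Inductive formula : Type :=
  | Eq (t u : term)
  | Le (t u : term)
  | Bot
  | Imp (p q : formula)
  | And (p q : formula)
  | Or (p q : formula)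
  | All (p : formula)
  | Ex (p : formula).

Definition Neg (p : formula) : formula := Imp p Bot.
Definition Iff (p q : formula) : formula := And (Imp p q) (Imp q p).

Fixpoint subst_term (s : nat -> term) (t : term) : term :=
  match t with
  | Var i => s i
  | Zero => Zero
  | Succ t => Succ (subst_term s t)
  | Plus t u => Plus (subst_term s t) (subst_term s u)
  | Times t u => Times (subst_term s t) (subst_term s u)
  end.

Definition shift_term : term -> term := subst_term (fun i => Var (S i)).

Definition up (s : nat -> term) (i : nat) : term :=
  match i with
  | O => Var 0
  | S j => shift_term (s j)
  end.

Fixpoint subst (s : nat -> term) (p : formula) : formula :=
  match p with
  | Eq t u => Eq (subst_term s t) (subst_term s u)
  | Le t u => Le (subst_term s t) (subst_term s u)
  | Bot => Bot
  | Imp p q => Imp (subst s p) (subst s q)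
  | And p q => And (subst s p) (subst s q)
  | Or p q => Or (subst s p) (subst s q)
  | All p => All (subst (up s) p)
  | Ex p => Ex (subst (up s) p)
  end.

Definition shift : formula -> formula := subst (fun i => Var (S i)).

(* Replaces variable 0 by [t] and lowers all the other free variables. *)
Definition inst (t : term) : formula -> formula :=
  subst (fun i => match i with O => t | S j => Var j end).

(* [below_term n t] and [below n p]: all free variables have index < n. *)
Fixpoint below_term (n : nat) (t : term) : Prop :=
  match t with
  | Var i => i < n
  | Zero => True
  | Succ t => below_term n t
  | Plus t u | Times t u => below_term n t /\ below_term n u
  end.

Fixpoint below (n : nat) (p : formula) : Prop :=
  match p with
  | Eq t u | Le t u => below_term n t /\ below_term n u
  | Bot => True
  | Imp p q | And p q | Or p q => below n p /\ below n q
  | All p | Ex p => below (S n) p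
  end.

Definition sentence : formula -> Prop := below 0.

(** * Provability: classical natural deduction with equality *)

Inductive nd : list formula -> formula -> Prop :=
  | nd_hyp G p : In p G -> nd G p
  | nd_impI G p q : nd (p :: G) q -> nd G (Imp p q)
  | nd_impE G p q : nd G (Imp p q) -> nd G p -> nd G q
  | nd_botE G p : nd G Bot -> nd G p
  | nd_raa G p : nd (Neg p :: G) Bot -> nd G p
  | nd_andI G p q : nd G p -> nd G q -> nd G (And p q)
  | nd_andE1 G p q : nd G (And p q) -> nd G p
  | nd_andE2 G p q : nd G (And p q) -> nd G q
  | nd_orI1 G p q : nd G p -> nd G (Or p q)
  | nd_orI2 G p q : nd G q -> nd G (Or p q)
  | nd_orE G p q r :
      nd G (Or p q) -> nd (p :: G) r -> nd (q :: G) r -> nd G r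
  | nd_allI G p : nd (map shift G) p -> nd G (All p)
  | nd_allE G p t : nd G (All p) -> nd G (inst t p)
  | nd_exI G p t : nd G (inst t p) -> nd G (Ex p)
  | nd_exE G p q :
      nd G (Ex p) -> nd (p :: map shift G) (shift q) -> nd G q
  | nd_eq_refl G t : nd G (Eq t t)
  | nd_eq_subst G p t u :
      nd G (Eq t u) -> nd G (inst t p) -> nd G (inst u p).

(* A theory is given by its set of axioms. *)
Definition theory : Type := formula -> Prop.

Definition proves (T : theory) (p : formula) : Prop :=
  exists G, Forall T G /\ nd G p.

Definition consistent (T : theory) : Prop := ~ proves T Bot.

Definition extends (T U : theory) : Prop :=
  forall p, proves U p -> proves T p.

(** * Peano arithmetic *)

(* In the induction step, p(x) becomes p(s x) with x still variable 0. *)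
Definition succ_inst : formula -> formula :=
  subst (fun i => match i with O => Succ (Var 0) | S _ => Var i end).

Definition induction (p : formula) : formula :=
  Imp (inst Zero p) (Imp (All (Imp p (succ_inst p))) (All p)).

Inductive PA : theory :=
  | PA_succ_neq_zero :
      PA (All (Neg (Eq (Succ (Var 0)) Zero)))
  | PA_succ_inj :
      PA (All (All (Imp (Eq (Succ (Var 1)) (Succ (Var 0)))
                        (Eq (Var 1) (Var 0)))))
  | PA_plus_zero :
      PA (All (Eq (Plus (Var 0) Zero) (Var 0)))
  | PA_plus_succ :
      PA (All (All (Eq (Plus (Var 1) (Succ (Var 0)))
                       (Succ (Plus (Var 1) (Var 0))))))
  | PA_times_zero :
      PA (All (Eq (Times (Var 0) Zero) Zero))
  | PA_times_succ :
      PA (All (All (Eq (Times (Var 1) (Succ (Var 0)))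
                       (Plus (Times (Var 1) (Var 0)) (Var 1)))))
  | PA_le :
      PA (All (All (Iff (Le (Var 1) (Var 0))
                        (Ex (Eq (Plus (Var 2) (Var 0)) (Var 1))))))
  (* Any prefix of universal quantifiers that closes the instance is allowed. *)
  | PA_induction p n :
      sentence (Nat.iter n All (induction p)) ->
      PA (Nat.iter n All (induction p)).

(** * Arithmetical hierarchy *)

Inductive Delta0 : formula -> Prop :=
  | Delta0_eq t u : Delta0 (Eq t u)
  | Delta0_le t u : Delta0 (Le t u)
  | Delta0_bot : Delta0 Bot
  | Delta0_imp p q : Delta0 p -> Delta0 q -> Delta0 (Imp p q)
  | Delta0_and p q : Delta0 p -> Delta0 q -> Delta0 (And p q)
  | Delta0_or p q : Delta0 p -> Delta0 q -> Delta0 (Or p q)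
  (* The bound [t] is shifted, so it does not contain the quantified variable. *)
  | Delta0_all t p :
      Delta0 p -> Delta0 (All (Imp (Le (Var 0) (shift_term t)) p))
  | Delta0_ex t p :
      Delta0 p -> Delta0 (Ex (And (Le (Var 0) (shift_term t)) p)).

Inductive Sigma1 : formula -> Prop :=
  | Sigma1_Delta0 p : Delta0 p -> Sigma1 p
  | Sigma1_ex p : Sigma1 p -> Sigma1 (Ex p).

(** * Goedel numbering *)

Definition tag (k c : nat) : nat := Cantor.to_nat (k, c).

Fixpoint code_term (t : term) : nat :=
  match t with
  | Var i => tag 0 i
  | Zero => tag 1 0
  | Succ t => tag 2 (code_term t)
  | Plus t u => tag 3 (Cantor.to_nat (code_term t, code_term u))
  | Times t u => tag 4 (Cantor.to_nat (code_term t, code_term u))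
  end.

Fixpoint code (p : formula) : nat :=
  match p with
  | Eq t u => tag 0 (Cantor.to_nat (code_term t, code_term u))
  | Le t u => tag 1 (Cantor.to_nat (code_term t, code_term u))
  | Bot => tag 2 0
  | Imp p q => tag 3 (Cantor.to_nat (code p, code q))
  | And p q => tag 4 (Cantor.to_nat (code p, code q))
  | Or p q => tag 5 (Cantor.to_nat (code p, code q))
  | All p => tag 6 (code p)
  | Ex p => tag 7 (code p)
  end.

Lemma to_nat_inj a b c d :
  Cantor.to_nat (a, b) = Cantor.to_nat (c, d) -> a = c /\ b = d.
Proof.
  intros H. apply (f_equal Cantor.of_nat) in H.
  rewrite !Cantor.cancel_of_to in H. now injection H.
Qed.

Lemma code_term_inj t u : code_term t = code_term u -> t = u.
Proof.
  revert u; induction t; intros [ ] H; apply to_nat_inj in H;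
    destruct H as [H0 H]; try discriminate H0;
    try (apply to_nat_inj in H; destruct H); f_equal; auto.
Qed.

Lemma code_inj p q : code p = code q -> p = q.
Proof.
  revert q; induction p; intros [ ] H; apply to_nat_inj in H;
    destruct H as [H0 H]; try discriminate H0;
    try (apply to_nat_inj in H; destruct H); f_equal; auto using code_term_inj.
Qed.

Fixpoint numeral (n : nat) : term :=
  match n with
  | O => Zero
  | S m => Succ (numeral m)
  end.

Definition quote (p : formula) : term := numeral (code p).

(** * Computable enumerability, via partial recursive functions *)

Inductive recfun : Type :=
  | RZero
  | RSucc
  | RProj (i : nat)
  | RComp (f : recfun) (gs : list recfun)
  | RPrec (f g : recfun)
  | RMu (f : recfun).

(* [reval f xs y]: the program f converges on the arguments xs with value y. *)
Inductive reval : recfun -> list nat -> nat -> Prop :=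
  | reval_zero xs : reval RZero xs 0
  | reval_succ x xs : reval RSucc (x :: xs) (S x)
  | reval_proj i xs y : nth_error xs i = Some y -> reval (RProj i) xs y
  | reval_comp f gs xs ys z :
      Forall2 (fun g y => reval g xs y) gs ys -> reval f ys z ->
      reval (RComp f gs) xs z
  | reval_prec_zero f g xs y :
      reval f xs y -> reval (RPrec f g) (0 :: xs) y
  | reval_prec_succ f g n xs y z :
      reval (RPrec f g) (n :: xs) y -> reval g (n :: y :: xs) z ->
      reval (RPrec f g) (S n :: xs) z
  | reval_mu f xs y :
      reval f (y :: xs) 0 ->
      (forall z, z < y -> exists w, reval f (z :: xs) (S w)) ->
      reval (RMu f) xs y.

Definition ce_set (A : nat -> Prop) : Prop :=
  exists f, forall x, A x <-> exists y, reval f [x] y.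

Definition ce_theory (T : theory) : Prop :=
  ce_set (fun x => exists p, T p /\ x = code p).

Definition consistent_ce_extension_of_PA (T : theory) : Prop :=
  (forall p, T p -> sentence p) /\ ce_theory T /\ extends T PA /\ consistent T.

(** * Provability predicates *)

(* Pr(<p>), for a formula Pr(x) whose only free variable x is variable 0. *)
Definition pr (Pr p : formula) : formula := inst (quote p) Pr.

Fixpoint pr_iter (Pr : formula) (i : nat) (p : formula) : formula :=
  match i with
  | O => p
  | S j => pr Pr (pr_iter Pr j p)
  end.

Definition provability_predicate (S T : theory) (Pr : formula) : Prop :=
  below 1 Pr /\ forall p, proves T p <-> proves S (pr Pr p).

Definition cond_C (S : theory) (Pr : formula) : Prop :=
  forall p q, proves S (Imp (And (pr Pr p) (pr Pr q)) (pr Pr (And p q))).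

Definition cond_D3 (S : theory) (Pr : formula) (n m : nat) : Prop :=
  forall p, proves S (Imp (pr_iter Pr n p) (pr_iter Pr m p)).

Definition cond_Ros (T : theory) (Pr : formula) : Prop :=
  forall p, proves T (Neg p) -> proves T (Neg (pr Pr p)).

(* Main.v *)
(** By [C] and [Ros], if [T] refutes [p /\ q] then it refutes
    [Pr <p> /\ Pr <q>], hence [Pr^i <p> /\ Pr^i <q>] for all [i].  Iterating
    [D3] replaces [k] by a multiple [K >= n].  For a fixed point [X] of
    [~ Pr^K <X>], [T] refutes [X /\ Pr^K <X>], hence [Pr^n <X> /\ Pr^(n+K) <X>],
    hence [Pr^n <X>] by [D3], hence [Pr^K <X>] by [Ros].  So [T] proves [X], and
    then also [Pr^K <X>], a contradiction.

    For the fixed point, [X |-> Pr^(K-1) <X>] acts on codes through pairing,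
    constants and the function sending [n] to the code of its numeral.  Graphs of
    such functions are given by bounded formulas with a bound [v] on all
    witnesses; [T] decides their numerical instances, and a clause quantifying
    over smaller witnesses makes them provably functional. *)

From Stdlib Require Import Arith List Cantor Lia.
Require Import Defs.
Import ListNotations.

(** * Substitution calculus for de Bruijn terms and formulas, and weakening *)

Definition scons {A : Type} (a : A) (s : nat -> A) (i : nat) : A :=
  match i with O => a | S j => s j end.

Lemma subst_term_ext s s' t :
  (forall i, s i = s' i) -> subst_term s t = subst_term s' t.
Proof. intros H; induction t; simpl; congruence. Qed.

Lemma up_ext s s' : (forall i, s i = s' i) -> forall i, up s i = up s' i.
Proof. intros H [|i]; simpl; congruence. Qed.

Lemma subst_ext p : forall s s',
  (forall i, s i = s' i) -> subst s p = subst s' p.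
Proof.
  induction p; intros s s' H; simpl; f_equal; auto using subst_term_ext, up_ext.
Qed.

Lemma subst_term_comp s s' t :
  subst_term s' (subst_term s t) = subst_term (fun i => subst_term s' (s i)) t.
Proof. induction t; simpl; congruence. Qed.

Lemma up_shift s t :
  subst_term (up s) (shift_term t) = shift_term (subst_term s t).
Proof.
  unfold shift_term; rewrite !subst_term_comp; now apply subst_term_ext.
Qed.

Lemma up_comp s s' i :
  subst_term (up s') (up s i) = up (fun j => subst_term s' (s j)) i.
Proof. destruct i as [|i]; simpl; auto using up_shift. Qed.

Lemma subst_comp p : forall s s',
  subst s' (subst s p) = subst (fun i => subst_term s' (s i)) p.
Proof.
  induction p; intros s s'; simpl; f_equal; auto using subst_term_comp;
    rewrite IHp; apply subst_ext, up_comp.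
Qed.

Lemma subst_term_id s t : (forall i, s i = Var i) -> subst_term s t = t.
Proof. intros H; induction t; simpl; congruence. Qed.

Lemma subst_term_below n s s' t :
  below_term n t -> (forall i, i < n -> s i = s' i) ->
  subst_term s t = subst_term s' t.
Proof. intros B H; induction t; simpl in *; f_equal; intuition auto. Qed.

Lemma subst_below p : forall n s s',
  below n p -> (forall i, i < n -> s i = s' i) -> subst s p = subst s' p.
Proof.
  assert (U : forall n s s', (forall i, i < n -> s i = s' i) ->
             forall i, i < S n -> up s i = up s' i).
  { intros n s s' H [|i] Hi; simpl; [|rewrite H]; auto with arith. }
  induction p; intros n s s' B H; simpl in *; f_equal;
    intuition eauto using subst_term_below.
Qed.

Lemma subst_id p : forall s, (forall i, s i = Var i) -> subst s p = p.
Proof.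
  induction p; intros s H; simpl; f_equal; auto using subst_term_id;
    apply IHp; intros [|i]; simpl; now rewrite ?H.
Qed.

Lemma shift_sentence p : sentence p -> shift p = p.
Proof.
  intros H; unfold shift; rewrite <- (subst_id p Var) at 2 by auto.
  apply subst_below with (1 := H); intros i Hi; inversion Hi.
Qed.

(** Lowering after lifting cancels the shift, so instantiating a quantifier body becomes one
    simultaneous substitution. *)
Lemma inst_up t s p : inst t (subst (up s) p) = subst (scons t s) p.
Proof.
  unfold inst; rewrite subst_comp; apply subst_ext; intros [|i]; simpl; auto.
  unfold shift_term; rewrite subst_term_comp; now apply subst_term_id.
Qed.

Lemma subst_numeral s n : subst_term s (numeral n) = numeral n.
Proof. induction n; simpl; congruence. Qed.

Lemma shift_numeral n : shift_term (numeral n) = numeral n.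
Proof. apply subst_numeral. Qed.

Lemma inst_shift_term u t :
  subst_term (fun i => match i with O => u | S j => Var j end) (shift_term t) = t.
Proof.
  unfold shift_term; rewrite subst_term_comp; now apply subst_term_id.
Qed.

Lemma nd_weaken G p : nd G p -> forall H, incl G H -> nd H p.
Proof.
  assert (C : forall (q : formula) A B, incl A B -> incl (q :: A) (q :: B)).
  { intros q A B I x [E|E]; [left|right]; auto. }
  induction 1; intros K I.
  - apply nd_hyp; auto.
  - apply nd_impI; auto.
  - eapply nd_impE; auto.
  - apply nd_botE; auto.
  - apply nd_raa; auto.
  - apply nd_andI; auto.
  - eapply nd_andE1; auto.
  - eapply nd_andE2; auto.
  - apply nd_orI1; auto.
  - apply nd_orI2; auto.
  - eapply nd_orE; auto.
  - apply nd_allI, IHnd, incl_map, I.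
  - apply nd_allE; auto.
  - eapply nd_exI; auto.
  - eapply nd_exE; [auto|]. apply IHnd2, C, incl_map, I.
  - apply nd_eq_refl.
  - eapply nd_eq_subst; auto.
Qed.

(** * Derivations from hypotheses over a theory with closed axioms *)

(** Hypotheses are kept apart from axioms because the quantifier rules shift only the former: axioms
    will be sentences, which shifting fixes. For empty [G] this is [proves T p] by conversion. *)
Definition prv (T : theory) (G : list formula) (p : formula) : Prop :=
  exists A, Forall T A /\ nd (G ++ A) p.

Lemma prv_weaken T G H p : prv T G p -> incl G H -> prv T H p.
Proof.
  intros (A & HA & D) I; exists A; split; auto.
  apply nd_weaken with (1 := D); intros x Hx.
  apply in_app_iff in Hx; apply in_app_iff; intuition.
Qed.

Lemma prv_proves T G p : proves T p -> prv T G p.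
Proof.
  intros H. apply prv_weaken with (G := []); [exact H | intros x []].
Qed.

Lemma prv_hyp T G p : In p G -> prv T G p.
Proof. intros H; exists []; split; auto. apply nd_hyp, in_app_iff; auto. Qed.

Lemma prv_impI T G p q : prv T (p :: G) q -> prv T G (Imp p q).
Proof. intros (A & HA & D); exists A; split; auto. now apply nd_impI. Qed.

Lemma prv_impE T G p q : prv T G (Imp p q) -> prv T G p -> prv T G q.
Proof.
  intros (A & HA & D) (B & HB & E); exists (A ++ B); split.
  - apply Forall_app; auto.
  - apply nd_impE with p; eapply nd_weaken; eauto;
      intros x; rewrite !in_app_iff; tauto.
Qed.

Lemma prv_cut T G p q : prv T G p -> prv T (p :: G) q -> prv T G q.
Proof. intros H K; eapply prv_impE; eauto using prv_impI. Qed.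

Lemma prv_nd T G p q : (forall H, nd (p :: H) q) -> prv T G p -> prv T G q.
Proof.
  intros D H; eapply prv_impE; eauto.
  apply prv_impI; exists []; split; auto. simpl; apply D.
Qed.

Lemma prv_botE T G p : prv T G Bot -> prv T G p.
Proof.
  apply prv_nd; intros; apply nd_botE, nd_hyp; now left.
Qed.

Lemma prv_andI T G p q : prv T G p -> prv T G q -> prv T G (And p q).
Proof.
  intros H K; apply (prv_impE _ _ q); auto. revert H; apply prv_nd; intros.
  apply nd_impI, nd_andI; apply nd_hyp; simpl; auto.
Qed.

Lemma prv_andE1 T G p q : prv T G (And p q) -> prv T G p.
Proof. apply prv_nd; intros; eapply nd_andE1, nd_hyp; left; eauto. Qed.

Lemma prv_andE2 T G p q : prv T G (And p q) -> prv T G q.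
Proof. apply prv_nd; intros; eapply nd_andE2, nd_hyp; left; eauto. Qed.

Lemma prv_orI1 T G p q : prv T G p -> prv T G (Or p q).
Proof. apply prv_nd; intros; apply nd_orI1, nd_hyp; now left. Qed.

Lemma prv_orI2 T G p q : prv T G q -> prv T G (Or p q).
Proof. apply prv_nd; intros; apply nd_orI2, nd_hyp; now left. Qed.

Lemma prv_orE T G p q r :
  prv T G (Or p q) -> prv T (p :: G) r -> prv T (q :: G) r -> prv T G r.
Proof.
  intros H K L; apply prv_impI in K; apply prv_impI in L.
  eapply prv_impE, L; eapply prv_impE, K; revert H; apply prv_nd; intros.
  apply nd_impI, nd_impI; apply (nd_orE _ p q); [apply nd_hyp; simpl; tauto| |].
  - apply (nd_impE _ p); apply nd_hyp; simpl; tauto.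
  - apply (nd_impE _ q); apply nd_hyp; simpl; tauto.
Qed.

Lemma prv_allE T G p t : prv T G (All p) -> prv T G (inst t p).
Proof. apply prv_nd; intros; apply nd_allE, nd_hyp; now left. Qed.

Lemma prv_exI T G p t : prv T G (inst t p) -> prv T G (Ex p).
Proof. apply prv_nd; intros; eapply nd_exI, nd_hyp; left; eauto. Qed.

Lemma prv_eq_refl T G t : prv T G (Eq t t).
Proof. exists []; split; auto; apply nd_eq_refl. Qed.

(** Side terms enter through [s], so [p] can be a bare pattern of variables and congruence rules
    need no shifted terms. *)
Lemma prv_eq_subst T G t u s p :
  prv T G (Eq t u) -> prv T G (subst (scons t s) p) ->
  prv T G (subst (scons u s) p).
Proof.
  rewrite <- !inst_up; intros H K; eapply prv_impE, K.
  revert H; apply prv_nd; intros; apply nd_impI.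
  eapply nd_eq_subst; apply nd_hyp; simpl; eauto.
Qed.

Definition closed_axioms (T : theory) : Prop := forall p, T p -> sentence p.

Lemma map_shift_axioms T A : closed_axioms T -> Forall T A -> map shift A = A.
Proof.
  intros HT; induction 1; simpl; f_equal; auto using shift_sentence.
Qed.

Lemma prv_allI T G p :
  closed_axioms T -> prv T (map shift G) p -> prv T G (All p).
Proof.
  intros HT (A & HA & D); exists A; split; auto; apply nd_allI.
  now rewrite map_app, (map_shift_axioms T A).
Qed.

Lemma prv_exE T G p q :
  closed_axioms T ->
  prv T G (Ex p) -> prv T (p :: map shift G) (shift q) -> prv T G q.
Proof.
  intros HT H K; apply prv_cut with (1 := H); destruct K as (A & HA & D).
  exists A; split; auto; eapply nd_exE; [apply nd_hyp; now left|].
  eapply nd_weaken; eauto; simpl; rewrite map_app, (map_shift_axioms T A) by auto.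
  intros x; simpl; tauto.
Qed.

Lemma prv_eq_sym T G t u : prv T G (Eq t u) -> prv T G (Eq u t).
Proof.
  intros H; apply (prv_eq_subst T G t u (fun _ => t) (Eq (Var 0) (Var 1)));
    simpl; auto using prv_eq_refl.
Qed.

Lemma prv_eq_trans T G t u v :
  prv T G (Eq t u) -> prv T G (Eq u v) -> prv T G (Eq t v).
Proof.
  intros H K; apply (prv_eq_subst T G u v (fun _ => t) (Eq (Var 1) (Var 0)));
    simpl; auto.
Qed.

Lemma prv_eq_succ T G t u : prv T G (Eq t u) -> prv T G (Eq (Succ t) (Succ u)).
Proof.
  intros H; apply (prv_eq_subst T G t u (fun _ => t) (Eq (Succ (Var 1)) (Succ (Var 0))));
    simpl; auto using prv_eq_refl.
Qed.

Lemma prv_eq_plus T G t t' u u' :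
  prv T G (Eq t t') -> prv T G (Eq u u') ->
  prv T G (Eq (Plus t u) (Plus t' u')).
Proof.
  intros H K.
  apply (prv_eq_subst T G t t' (scons (Plus t u) (fun _ => u'))
           (Eq (Var 1) (Plus (Var 0) (Var 2)))); auto.
  apply (prv_eq_subst T G u u' (scons (Plus t u) (fun _ => t))
           (Eq (Var 1) (Plus (Var 2) (Var 0)))); simpl; auto using prv_eq_refl.
Qed.

Lemma prv_eq_times T G t t' u u' :
  prv T G (Eq t t') -> prv T G (Eq u u') ->
  prv T G (Eq (Times t u) (Times t' u')).
Proof.
  intros H K.
  apply (prv_eq_subst T G t t' (scons (Times t u) (fun _ => u'))
           (Eq (Var 1) (Times (Var 0) (Var 2)))); auto.
  apply (prv_eq_subst T G u u' (scons (Times t u) (fun _ => t))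
           (Eq (Var 1) (Times (Var 2) (Var 0)))); simpl; auto using prv_eq_refl.
Qed.

Lemma prv_le_eq T G t t' u u' :
  prv T G (Eq t t') -> prv T G (Eq u u') ->
  prv T G (Le t u) -> prv T G (Le t' u').
Proof.
  intros H K L.
  apply (prv_eq_subst T G t t' (fun _ => u') (Le (Var 0) (Var 1))); auto.
  apply (prv_eq_subst T G u u' (fun _ => t) (Le (Var 1) (Var 0))); simpl; auto.
Qed.

(** * Arithmetic in extensions of PA *)

Definition PA_ext (T : theory) : Prop := closed_axioms T /\ extends T PA.

Lemma prv_PA T G p : PA_ext T -> PA p -> prv T G p.
Proof.
  intros [_ E] H; apply prv_proves, E; exists [p]; split; auto.
  apply nd_hyp; now left.
Qed.

Lemma prv_succ_neq_zero T G t q :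
  PA_ext T -> prv T G (Eq (Succ t) Zero) -> prv T G q.
Proof.
  intros E H; apply prv_botE; eapply prv_impE, H.
  exact (prv_allE _ _ _ t (prv_PA T G _ E PA_succ_neq_zero)).
Qed.

Lemma prv_succ_inj T G t u :
  PA_ext T -> prv T G (Eq (Succ t) (Succ u)) -> prv T G (Eq t u).
Proof.
  intros E H; eapply prv_impE, H.
  pose proof (prv_allE _ _ _ u (prv_allE _ _ _ t (prv_PA T G _ E PA_succ_inj))) as K.
  cbn in K; now rewrite inst_shift_term in K.
Qed.

Lemma prv_plus_zero T G t : PA_ext T -> prv T G (Eq (Plus t Zero) t).
Proof.
  intros E; exact (prv_allE _ _ _ t (prv_PA T G _ E PA_plus_zero)).
Qed.

Lemma prv_plus_succ T G t u :
  PA_ext T -> prv T G (Eq (Plus t (Succ u)) (Succ (Plus t u))).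
Proof.
  intros E.
  pose proof (prv_allE _ _ _ u (prv_allE _ _ _ t (prv_PA T G _ E PA_plus_succ))) as K.
  cbn in K; now rewrite inst_shift_term in K.
Qed.

Lemma prv_times_zero T G t : PA_ext T -> prv T G (Eq (Times t Zero) Zero).
Proof.
  intros E; exact (prv_allE _ _ _ t (prv_PA T G _ E PA_times_zero)).
Qed.

Lemma prv_times_succ T G t u :
  PA_ext T -> prv T G (Eq (Times t (Succ u)) (Plus (Times t u) t)).
Proof.
  intros E.
  pose proof (prv_allE _ _ _ u (prv_allE _ _ _ t (prv_PA T G _ E PA_times_succ))) as K.
  cbn in K; now rewrite inst_shift_term in K.
Qed.

Lemma prv_le T G t u :
  PA_ext T ->
  prv T G (Iff (Le t u) (Ex (Eq (Plus (shift_term t) (Var 0)) (shift_term u)))).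
Proof.
  intros E.
  pose proof (prv_allE _ _ _ u (prv_allE _ _ _ t (prv_PA T G _ E PA_le))) as K.
  cbn in K; now rewrite !up_shift, !inst_shift_term in K.
Qed.

Lemma prv_leI T G t u z :
  PA_ext T -> prv T G (Eq (Plus t z) u) -> prv T G (Le t u).
Proof.
  intros E H; eapply prv_impE; [eapply prv_andE2, prv_le, E|].
  apply (prv_exI _ _ _ z); cbn; now rewrite !inst_shift_term.
Qed.

Lemma prv_leE T G t u q :
  PA_ext T -> prv T G (Le t u) ->
  prv T (Eq (Plus (shift_term t) (Var 0)) (shift_term u) :: map shift G) (shift q) ->
  prv T G q.
Proof.
  intros E H K; eapply prv_exE; [apply E| |apply K].
  eapply prv_impE, H; eapply prv_andE1, prv_le, E.
Qed.

Lemma below_shift_term n t : below_term n t -> below_term (S n) (shift_term t).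
Proof. induction t; cbn; intuition auto with arith. Qed.

Lemma below_subst_term m n s t :
  below_term m t -> (forall i, i < m -> below_term n (s i)) ->
  below_term n (subst_term s t).
Proof. intros B H; induction t; cbn in *; intuition auto. Qed.

Lemma below_subst p : forall m n s,
  below m p -> (forall i, i < m -> below_term n (s i)) -> below n (subst s p).
Proof.
  induction p; intros m n s B H; cbn in *; intuition eauto using below_subst_term.
  all: apply (IHp (S m)); auto; intros [|i] Hi; cbn; auto with arith.
  all: apply below_shift_term, H; lia.
Qed.

(** Only variable 0 may be free in [p], so its induction axiom is a sentence with an empty
    quantifier prefix. The premises carry no side hypotheses, so generalizing the step shifts
    nothing. *)
Lemma prv_induction T G p t :
  PA_ext T -> below 1 p ->
  prv T [] (inst Zero p) -> prv T [p] (succ_inst p) -> prv T G (inst t p).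
Proof.
  intros E B H K; apply prv_allE, (prv_weaken _ []); [|intros x []].
  eapply prv_impE; [eapply prv_impE|]; [|exact H|].
  - apply prv_PA; [exact E|]; apply (PA_induction p 0); cbn.
    repeat split; auto; apply (below_subst _ 1); auto;
      intros [|i] Hi; cbn; auto; lia.
  - apply prv_allI; [apply E|]; now apply prv_impI.
Qed.

Lemma prv_zero_or_succ T G t q :
  PA_ext T ->
  prv T (Eq t Zero :: G) q ->
  prv T (Eq (shift_term t) (Succ (Var 0)) :: map shift G) (shift q) ->
  prv T G q.
Proof.
  intros E H K.
  pose (p := Or (Eq (Var 0) Zero) (Ex (Eq (Var 1) (Succ (Var 0))))).
  assert (C : prv T G (inst t p)).
  { apply prv_induction; [exact E|cbn; intuition lia| |]; cbn.
    - apply prv_orI1, prv_eq_refl.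
    (* In the induction step the variable itself is the predecessor of its successor. *)
    - apply prv_orI2, (prv_exI _ _ _ (Var 0)), prv_eq_refl. }
  eapply prv_orE; [exact C|exact H|].
  eapply prv_exE; [apply E|apply prv_hyp; now left|].
  eapply prv_weaken; [exact K|]; intros x; simpl; tauto.
Qed.

Lemma prv_le_zero T G t : PA_ext T -> prv T G (Le t Zero) -> prv T G (Eq t Zero).
Proof.
  assert (C : forall t z w G, PA_ext T -> prv T G (Eq z (Succ w)) ->
                prv T G (Eq (Plus t z) Zero) -> prv T G (Eq t Zero)).
  { intros t0 z w G0 E H K; apply prv_succ_neq_zero with (t := Plus t0 w); auto.
    eapply prv_eq_trans, K; apply prv_eq_sym.
    eapply prv_eq_trans; [apply prv_eq_plus; [apply prv_eq_refl|exact H]|].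
    now apply prv_plus_succ. }
  intros E H; apply prv_leE with (2 := H); auto; cbn.
  apply prv_zero_or_succ with (t := Var 0); auto; cbn.
  - eapply prv_eq_trans; [apply prv_eq_sym, prv_plus_zero, E|].
    apply prv_eq_trans with (Plus (shift_term t) (Var 0));
      [|apply prv_hyp; simpl; tauto].
    apply prv_eq_plus; [apply prv_eq_refl|].
    apply prv_eq_sym, prv_hyp; simpl; tauto.
  - apply C with (z := Var 1) (w := Var 0); auto; apply prv_hyp; simpl; tauto.
Qed.

(** Case distinction on the difference [z] in t + z = s u: z = 0 gives the equality, and z = s w
    gives t + w = u by injectivity of successor. *)
Lemma prv_le_succ T G t u :
  PA_ext T -> prv T G (Le t (Succ u)) ->
  prv T G (Or (Eq t (Succ u)) (Le t u)).
Proof.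
  assert (C : forall t u z w G, PA_ext T -> prv T G (Eq z (Succ w)) ->
                prv T G (Eq (Plus t z) (Succ u)) -> prv T G (Le t u)).
  { intros t0 u0 z w G0 E H K; apply prv_leI with w; auto.
    apply prv_succ_inj; auto; eapply prv_eq_trans, K; apply prv_eq_sym.
    eapply prv_eq_trans; [apply prv_eq_plus; [apply prv_eq_refl|exact H]|].
    now apply prv_plus_succ. }
  intros E H; apply prv_leE with (2 := H); auto; cbn.
  apply prv_zero_or_succ with (t := Var 0); auto; cbn.
  - apply prv_orI1.
    eapply prv_eq_trans; [apply prv_eq_sym, prv_plus_zero, E|].
    apply prv_eq_trans with (Plus (shift_term t) (Var 0));
      [|apply prv_hyp; simpl; tauto].
    apply prv_eq_plus; [apply prv_eq_refl|].
    apply prv_eq_sym, prv_hyp; simpl; tauto.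
  - apply prv_orI2, C with (z := Var 1) (w := Var 0); auto;
      apply prv_hyp; simpl; tauto.
Qed.

(** This replaces a bounded quantifier inside the theory by finitely many cases; the induction on
    [n] is external. *)
Lemma prv_le_numeral_cases T n : forall G t q,
  PA_ext T -> prv T G (Le t (numeral n)) ->
  (forall i, i <= n -> prv T (Eq t (numeral i) :: G) q) -> prv T G q.
Proof.
  induction n as [|n IH]; cbn; intros G t q E H K.
  - eapply prv_cut; [apply prv_le_zero; eauto|exact (K 0 (le_n 0))].
  - eapply prv_orE; [apply prv_le_succ; eauto|exact (K (S n) (le_n _))|].
    apply IH with t; auto; [apply prv_hyp; now left|].
    intros i Hi; eapply prv_weaken; [apply (K i); auto|].
    intros x; simpl; tauto.
Qed.

Lemma prv_plus_numeral T G a b :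
  PA_ext T -> prv T G (Eq (Plus (numeral a) (numeral b)) (numeral (a + b))).
Proof.
  intros E; induction b as [|b IH]; cbn.
  - rewrite Nat.add_0_r; now apply prv_plus_zero.
  - rewrite Nat.add_succ_r; cbn.
    eapply prv_eq_trans; [now apply prv_plus_succ|now apply prv_eq_succ].
Qed.

Lemma prv_times_numeral T G a b :
  PA_ext T -> prv T G (Eq (Times (numeral a) (numeral b)) (numeral (a * b))).
Proof.
  intros E; induction b as [|b IH]; cbn.
  - rewrite Nat.mul_0_r; now apply prv_times_zero.
  - rewrite Nat.mul_succ_r.
    eapply prv_eq_trans; [now apply prv_times_succ|].
    eapply prv_eq_trans; [|now apply prv_plus_numeral].
    apply prv_eq_plus; auto using prv_eq_refl.
Qed.

Lemma prv_numeral_neq T a : forall G b q,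
  PA_ext T -> a <> b -> prv T G (Eq (numeral a) (numeral b)) -> prv T G q.
Proof.
  induction a as [|a IH]; intros G [|b] q E N H; cbn in H.
  - congruence.
  - eapply prv_succ_neq_zero; eauto using prv_eq_sym.
  - eapply prv_succ_neq_zero; eauto.
  - apply (IH G b); auto using prv_succ_inj.
Qed.

Lemma prv_numeral_le T G a b :
  PA_ext T -> a <= b -> prv T G (Le (numeral a) (numeral b)).
Proof.
  intros E H; apply prv_leI with (numeral (b - a)); auto.
  replace (numeral b) with (numeral (a + (b - a))) by (f_equal; lia).
  now apply prv_plus_numeral.
Qed.

Lemma prv_numeral_not_le T G a b q :
  PA_ext T -> b < a -> prv T G (Le (numeral a) (numeral b)) -> prv T G q.
Proof.
  intros E H K; apply prv_le_numeral_cases with (2 := K); auto.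
  intros i Hi; apply prv_numeral_neq with (a := a) (b := i); auto; [lia|].
  apply prv_hyp; now left.
Qed.

(** Internal induction on [t] with [n] fixed. If t <= n, then [t] is some numeral [i], and [S i] is
    compared with [n] outside the theory; if n <= t, then also n <= s t. *)
Lemma prv_le_numeral_total T G t n :
  PA_ext T -> prv T G (Or (Le t (numeral n)) (Le (numeral n) t)).
Proof.
  intros E.
  pose (p := Or (Le (Var 0) (numeral n)) (Le (numeral n) (Var 0))).
  assert (B : forall m, below_term m (numeral n))
    by (intros m; induction n; cbn; auto).
  assert (P : prv T G (inst t p)).
  { apply prv_induction; [exact E|cbn; auto with arith| |]; cbn;
      rewrite !subst_numeral.
    - apply prv_orI1; exact (prv_numeral_le T [] 0 n E (Nat.le_0_l n)).
    - eapply prv_orE; [apply prv_hyp; now left| |].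
      + apply prv_le_numeral_cases with (t := Var 0) (n := n); auto;
          [apply prv_hyp; now left|].
        intros i Hi.
        assert (Q : prv T (Eq (Var 0) (numeral i) :: Le (Var 0) (numeral n) :: [p])
                      (Eq (numeral (S i)) (Succ (Var 0)))).
        { apply prv_eq_sym; cbn; apply prv_eq_succ, prv_hyp; now left. }
        destruct (Nat.eq_dec i n) as [->|Ne].
        * apply prv_orI2; eapply prv_le_eq; [apply prv_eq_refl|exact Q|].
          apply prv_numeral_le; auto.
        * apply prv_orI1; eapply prv_le_eq; [exact Q|apply prv_eq_refl|].
          apply prv_numeral_le; auto; lia.
      + apply prv_orI2; apply prv_leE with (t := numeral n) (u := Var 0); auto;
          [apply prv_hyp; now left|]; cbn; rewrite !shift_numeral.
        apply prv_leI with (Succ (Var 0)); auto.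
        eapply prv_eq_trans; [now apply prv_plus_succ|].
        apply prv_eq_succ, prv_hyp; now left. }
  cbn in P; now rewrite !subst_numeral in P.
Qed.

(** * The standard model and the decision of bounded formulas *)

Fixpoint teval (r : nat -> nat) (t : term) : nat :=
  match t with
  | Var i => r i
  | Zero => 0
  | Succ t => S (teval r t)
  | Plus t u => teval r t + teval r u
  | Times t u => teval r t * teval r u
  end.

Fixpoint sat (r : nat -> nat) (p : formula) : Prop :=
  match p with
  | Eq t u => teval r t = teval r u
  | Le t u => teval r t <= teval r u
  | Bot => False
  | Imp p q => sat r p -> sat r q
  | And p q => sat r p /\ sat r q
  | Or p q => sat r p \/ sat r q
  | All p => forall a, sat (scons a r) p
  | Ex p => exists a, sat (scons a r) p
  end.

Lemma teval_shift r a t : teval (scons a r) (shift_term t) = teval r t.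
Proof. induction t; cbn; auto. Qed.

Lemma teval_numeral r n : teval r (numeral n) = n.
Proof. induction n; cbn; auto. Qed.

Lemma prv_teval T G r s t :
  PA_ext T -> (forall i, s i = numeral (r i)) ->
  prv T G (Eq (subst_term s t) (numeral (teval r t))).
Proof.
  intros E H; induction t; cbn.
  - rewrite H; apply prv_eq_refl.
  - apply prv_eq_refl.
  - now apply prv_eq_succ.
  - eapply prv_eq_trans; [apply prv_eq_plus; [apply IHt1|apply IHt2]|now apply prv_plus_numeral].
  - eapply prv_eq_trans; [apply prv_eq_times; [apply IHt1|apply IHt2]|now apply prv_times_numeral].
Qed.

(** A finite search, hence constructive. With two predicates instead of one and its negation, each
    outcome can carry a derivation along with a truth value. *)
Lemma bounded_forall_or_exists (P Q : nat -> Prop) n :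
  (forall i, P i \/ Q i) ->
  (forall i, i <= n -> P i) \/ (exists i, i <= n /\ Q i).
Proof.
  intros D; induction n as [|n [IH|(i & Hi & H)]].
  - destruct (D 0) as [H|H]; [left|right; eauto].
    intros i Hi; now replace i with 0 by lia.
  - destruct (D (S n)) as [H|H]; [left|right; eauto].
    intros i Hi; destruct (Nat.eq_dec i (S n)) as [->|]; auto; apply IH; lia.
  - right; exists i; auto.
Qed.

(** Truth and derivability are decided together by induction on [Delta0]; a bounded quantifier
    reduces to finitely many numerals by [prv_le_numeral_cases]. Every variable receives a numeral,
    so passing a binder merely extends [r] and [s]. *)
Lemma prv_Delta0 T p : PA_ext T -> Delta0 p -> forall r s,
  (forall i, s i = numeral (r i)) ->
  (sat r p /\ forall G, prv T G (subst s p)) \/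
  (~ sat r p /\ forall G, prv T G (Neg (subst s p))).
Proof.
  intros E; induction 1 as [t u|t u| |p q _ IHp _ IHq|p q _ IHp _ IHq
    |p q _ IHp _ IHq|t p _ IHp|t p _ IHp]; intros r s Hs; cbn.
  - destruct (Nat.eq_dec (teval r t) (teval r u)) as [e|e]; [left|right];
      split; auto; intros G.
    + eapply prv_eq_trans; [apply (prv_teval _ _ r); auto|rewrite e].
      apply prv_eq_sym, (prv_teval _ _ r); auto.
    + apply prv_impI.
      apply prv_numeral_neq with (1 := E) (2 := e).
      eapply prv_eq_trans; [apply prv_eq_sym, (prv_teval _ _ r); auto|].
      eapply prv_eq_trans; [|apply (prv_teval _ _ r); auto]; apply prv_hyp; now left.
  - destruct (le_lt_dec (teval r t) (teval r u)) as [e|e]; [left|right].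
    + split; auto; intros G.
      eapply prv_le_eq; [apply prv_eq_sym, (prv_teval _ _ r); auto
        |apply prv_eq_sym, (prv_teval _ _ r); auto|now apply prv_numeral_le].
    + split; [lia|]; intros G; apply prv_impI.
      apply prv_numeral_not_le with (1 := E) (2 := e).
      eapply prv_le_eq; [apply (prv_teval _ _ r); auto|apply (prv_teval _ _ r); auto|].
      apply prv_hyp; now left.
  - right; split; auto; intros G; apply prv_impI, prv_hyp; now left.
  - destruct (IHp r s Hs) as [[P P']|[P P']].
    + destruct (IHq r s Hs) as [[Q Q']|[Q Q']]; [left|right]; split; auto; intros G.
      * now apply prv_impI.
      * apply prv_impI; eapply prv_impE; [apply Q'|].
        eapply prv_impE; [apply prv_hyp; now left|apply P'].
    + left; split; [tauto|]; intros G; apply prv_impI, prv_botE.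
      eapply prv_impE; [apply P'|apply prv_hyp; now left].
  - destruct (IHp r s Hs) as [[P P']|[P P']];
      [destruct (IHq r s Hs) as [[Q Q']|[Q Q']]|].
    + left; split; auto using prv_andI.
    + right; split; [tauto|]; intros G; apply prv_impI; eapply prv_impE; [apply Q'|].
      eapply prv_andE2, prv_hyp; now left.
    + right; split; [tauto|]; intros G; apply prv_impI; eapply prv_impE; [apply P'|].
      eapply prv_andE1, prv_hyp; now left.
  - destruct (IHp r s Hs) as [[P P']|[P P']];
      [|destruct (IHq r s Hs) as [[Q Q']|[Q Q']]].
    + left; split; auto using prv_orI1.
    + left; split; auto using prv_orI2.
    + right; split; [tauto|]; intros G; apply prv_impI.
      eapply prv_orE; [apply prv_hyp; now left| |].
      * eapply prv_impE; [apply P'|apply prv_hyp; now left].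
      * eapply prv_impE; [apply Q'|apply prv_hyp; now left].
  - assert (IH : forall i,
      (sat (scons i r) p /\ forall G, prv T G (subst (scons (numeral i) s) p)) \/
      (~ sat (scons i r) p /\
       forall G, prv T G (Neg (subst (scons (numeral i) s) p)))).
    { intros i; apply IHp; intros [|j]; cbn; auto. }
    rewrite up_shift.
    destruct (bounded_forall_or_exists _ _ (teval r t) IH) as [A|(i & Hi & N & N')].
    + left; split.
      { intros a Ha; rewrite teval_shift in Ha; now apply A. }
      intros G; apply prv_allI; [apply E|]; apply prv_impI.
      apply prv_le_numeral_cases with (t := Var 0) (n := teval r t); auto.
      { eapply prv_le_eq; [apply prv_eq_refl| |apply prv_hyp; now left].
        unfold shift_term; rewrite subst_term_comp; apply prv_teval; auto.
        intros j; rewrite Hs; apply subst_numeral. }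
      intros i Hi.
      (* The body is written as a trivial instance at [Var 0], so that the equality with [numeral i]
         can be used by [prv_eq_subst]. *)
      rewrite <- (subst_id (subst (up s) p) (scons (Var 0) (fun j => Var (S j))))
        by (now intros [|j]).
      apply prv_eq_subst with (numeral i).
      { apply prv_eq_sym, prv_hyp; now left. }
      rewrite subst_comp; erewrite subst_ext; [apply (A i Hi)|].
      intros [|j]; cbn; auto; now rewrite Hs, shift_numeral, subst_numeral.
    + right; split.
      { intros A; apply N, A; cbn; now rewrite teval_shift. }
      intros G; apply prv_impI; eapply prv_impE; [apply N'|].
      rewrite <- inst_up.
      eapply prv_impE.
      { exact (prv_allE T _ _ (numeral i) (prv_hyp T (_ :: G) _ (or_introl eq_refl))). }
      cbn; rewrite inst_shift_term.
      eapply prv_le_eq; [apply prv_eq_refl|apply prv_eq_sym, (prv_teval _ _ r); auto|].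
      now apply prv_numeral_le.
  (* The disjuncts are exchanged: the existential formula is refuted when all instances fail, and
     one true instance proves it. *)
  - assert (IH : forall i,
      (~ sat (scons i r) p /\
       forall G, prv T G (Neg (subst (scons (numeral i) s) p))) \/
      (sat (scons i r) p /\ forall G, prv T G (subst (scons (numeral i) s) p))).
    { intros i; apply or_comm, IHp; intros [|j]; cbn; auto. }
    rewrite up_shift.
    destruct (bounded_forall_or_exists _ _ (teval r t) IH) as [A|(i & Hi & N & N')].
    + right; split.
      { intros (a & Ha & P); rewrite teval_shift in Ha; now apply (A a). }
      intros G; apply prv_impI.
      eapply prv_exE; [apply E|apply prv_hyp; now left|]; cbn.
      apply prv_le_numeral_cases with (t := Var 0) (n := teval r t); auto.
      { eapply prv_le_eq; [apply prv_eq_refl|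
          |eapply prv_andE1, prv_hyp; now left].
        unfold shift_term; rewrite subst_term_comp; apply prv_teval; auto.
        intros j; rewrite Hs; apply subst_numeral. }
      intros i Hi; eapply prv_impE; [apply (A i Hi)|].
      rewrite (subst_ext p (scons (numeral i) s) (fun j => subst_term
                  (scons (numeral i) (fun j => Var (S j))) (up s j)));
        [|intros [|j]; cbn; auto; now rewrite Hs, shift_numeral, subst_numeral].
      rewrite <- subst_comp.
      apply prv_eq_subst with (Var 0); [apply prv_hyp; now left|].
      rewrite (subst_id (subst (up s) p) (scons (Var 0) (fun j => Var (S j))))
        by (now intros [|j]).
      eapply prv_andE2, prv_hyp; right; now left.
    + left; split.
      { exists i; rewrite teval_shift; auto. }
      intros G; apply (prv_exI _ _ _ (numeral i)); cbn.
      fold (inst (numeral i) (subst (up s) p)).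
      rewrite inst_up, inst_shift_term; apply prv_andI; auto.
      eapply prv_le_eq; [apply prv_eq_refl|apply prv_eq_sym, (prv_teval _ _ r); auto|].
      now apply prv_numeral_le.
Qed.

(** * Graphs of code-valued functions *)

(* A finite set of numbers [e >= 1] is coded by [b] and [c]: its elements are
   the [e] for which [1 + e c] divides [b].  With [c = M!] these moduli are
   pairwise coprime for [e <= M], so no Chinese remaindering is needed. *)
Lemma modulus_coprime M e e' :
  1 <= e <= M -> 1 <= e' <= M -> e <> e' ->
  Nat.gcd (S (e * fact M)) (S (e' * fact M)) = 1.
Proof.
  intros He He' N.
  set (c := fact M); set (g := Nat.gcd _ _).
  assert (F : forall d, 1 <= d <= M -> Nat.divide d c).
  { unfold c; clear; induction M as [|M IH]; intros d Hd; [lia|].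
    change (fact (S M)) with (S M * fact M).
    destruct (Nat.eq_dec d (S M)) as [->|]; [apply Nat.divide_factor_l|].
    apply Nat.divide_mul_r, IH; lia. }
  assert (G1 : Nat.divide g (S (e * c))) by apply Nat.gcd_divide_l.
  assert (G2 : Nat.divide g (S (e' * c))) by apply Nat.gcd_divide_r.
  (* A common divisor of 1 + xc and 1 + yc divides x(1 + yc) - y(1 + xc) = x - y, which is at most M
     and so divides c = M!. Dividing both c and a modulus, it must be 1. *)
  assert (Gd : forall x y, 1 <= x <= M -> y < x ->
            Nat.divide g (S (x * c)) -> Nat.divide g (S (y * c)) ->
            Nat.divide g c).
  { intros x y Hx Hy X Y; apply Nat.divide_trans with (x - y); [|apply F; lia].
    replace (x - y) with (x * S (y * c) - y * S (x * c)) by nia.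
    apply Nat.divide_sub_r; now apply Nat.divide_mul_r. }
  assert (Gc : Nat.divide g c).
  { destruct (Nat.lt_total e e') as [L|[L|L]]; [|contradiction|];
      [apply (Gd e' e)|apply (Gd e e')]; auto; lia. }
  apply Nat.divide_1_r; replace 1 with (S (e * c) - e * c) by lia.
  apply Nat.divide_sub_r; auto using Nat.divide_mul_r.
Qed.

Definition modulus_product (c : nat) (l : list nat) : nat :=
  fold_right (fun e b => S (e * c) * b) 1 l.

(** A modulus coprime to a factor cancels it by Gauss. If no factor equals it, it ends up dividing
    1, which is impossible as [e] and M! are positive. *)
Lemma modulus_divide_product M l e :
  (forall e', In e' l -> 1 <= e' <= M) -> 1 <= e <= M ->
  Nat.divide (S (e * fact M)) (modulus_product (fact M) l) <-> In e l.
Proof.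
  intros Hl He; split.
  - induction l as [|a l IH]; intros D.
    + exfalso; apply Nat.divide_1_r in D; pose proof (lt_O_fact M); nia.
    + destruct (Nat.eq_dec a e) as [->|N]; [now left|right]; apply IH.
      * intros e' I; apply Hl; now right.
      * apply Nat.gauss with (1 := D), modulus_coprime; auto.
        apply Hl; now left.
  - induction l as [|a l IH]; intros [].
    + subst; apply Nat.divide_factor_l.
    + apply Nat.divide_mul_r, IH; auto; intros e' I; apply Hl; now right.
Qed.

Lemma modulus_product_pos c l : 1 <= modulus_product c l.
Proof.
  induction l as [|a l IH]; [auto|].
  change (1 <= S (a * c) * modulus_product c l); nia.
Qed.

(** Twice the Cantor pairing, which is a polynomial and so expressible by a term without halving. *)
Definition dpair (i z : nat) : nat := (i + z) * S (i + z) + (z + z).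

Lemma dpair_to_nat i z : dpair i z = Cantor.to_nat (i, z) + Cantor.to_nat (i, z).
Proof. pose proof (Cantor.to_nat_spec i z); unfold dpair; nia. Qed.

Lemma dpair_inj i z i' z' : dpair i z = dpair i' z' -> i = i' /\ z = z'.
Proof. rewrite !dpair_to_nat; intros H; apply to_nat_inj; lia. Qed.

Lemma dpair_le N i z : i <= N -> z <= N -> dpair i z <= dpair N N.
Proof. unfold dpair; nia. Qed.

(** The pair (i, z) is represented by the element e = [S (dpair i z)], which is at least 1; the
    bound on the quotient keeps divisibility a bounded formula. *)
Definition mem (b c i z : nat) : Prop :=
  exists q, q <= b /\ q * S (S (dpair i z) * c) = b.

Definition numcode (n : nat) : nat := code_term (numeral n).

Lemma numcode_bound a : exists N, forall i, i <= a -> i <= N /\ numcode i <= N.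
Proof.
  induction a as [|a (N & H)].
  - exists (numcode 0); intros i Hi; replace i with 0 by lia; lia.
  - exists (N + S a + numcode (S a)); intros i Hi.
    destruct (Nat.eq_dec i (S a)) as [->|]; [lia|].
    destruct (H i); lia.
Qed.

(** The coded set is the graph of [numcode] up to [a]. [M] is at least the element of every pair
    with entries up to [N], so the divisibility test is exact on all these pairs and admits no
    spurious one. *)
Lemma numcode_set a : exists N b c, forall i z, i <= N -> z <= N ->
  (mem b c i z <-> i <= a /\ z = numcode i) /\ a <= N /\
  (forall j, j <= a -> numcode j <= N).
Proof.
  destruct (numcode_bound a) as (N & HN).
  set (M := S (dpair N N)).
  set (l := map (fun i => S (dpair i (numcode i))) (seq 0 (S a))).
  exists N, (modulus_product (fact M) l), (fact M); intros i z Hi Hz.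
  split; [|split; [now apply HN|intros j Hj; now apply HN]].
  assert (D : mem (modulus_product (fact M) l) (fact M) i z <->
              In (S (dpair i z)) l).
  { rewrite <- (modulus_divide_product M).
    - pose proof (modulus_product_pos (fact M) l).
      split; [intros (q & _ & E)|intros (q & E)]; exists q; [auto|split; [nia|auto]].
    - intros e I; apply in_map_iff in I; destruct I as (j & <- & I).
      apply in_seq in I; destruct (HN j); [lia|].
      pose proof (dpair_le N j (numcode j)); unfold M; lia.
    - pose proof (dpair_le N i z); unfold M; lia. }
  rewrite D; unfold l; rewrite in_map_iff; split.
  - intros (j & E & I); apply in_seq in I; injection E as E.
    apply dpair_inj in E; destruct E as [-> <-]; split; auto; lia.
  - intros [L ->]; exists i; split; auto; apply in_seq; lia.
Qed.

Definition BEx (t : term) (p : formula) : formula :=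
  Ex (And (Le (Var 0) (shift_term t)) p).
Definition BAll (t : term) (p : formula) : formula :=
  All (Imp (Le (Var 0) (shift_term t)) p).

Definition DpairT (i z : term) : term :=
  Plus (Times (Plus i z) (Succ (Plus i z))) (Plus z z).

Definition PairF (a b p : term) : formula := Eq (DpairT a b) (Plus p p).

Definition MemF (b c i z : term) : formula :=
  BEx b (Eq (Times (Var 0)
    (Succ (Times (Succ (DpairT (shift_term i) (shift_term z))) (shift_term c))))
    (shift_term b)).

Definition sh2 (t : term) : term := shift_term (shift_term t).
Definition sh3 (t : term) : term := shift_term (sh2 t).

(* "[y] is the code of the numeral [a]": a coded set contains [(a, y)], and its
   elements within the bound [N] are justified by the recursion for [numcode].
   The bound [N] is separate from the bound [v] on all witnesses, which makes
   the formula monotone in [v]. *)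
Definition NumF (a y v : term) : formula :=
  BEx v (BEx (shift_term v) (BEx (sh2 v)
    (And (Le (sh3 a) (Var 0)) (And (Le (sh3 y) (Var 0))
    (And (MemF (Var 2) (Var 1) (sh3 a) (sh3 y))
      (BAll (Var 0) (BAll (Var 1)
        (Imp (MemF (Var 4) (Var 3) (Var 1) (Var 0))
          (Or (And (Eq (Var 1) Zero) (Eq (Var 0) (numeral (numcode 0))))
            (BEx (Var 1) (BEx (Var 1)
              (And (Eq (Var 3) (Succ (Var 1)))
              (And (PairF (numeral 2) (Var 0) (Var 2))
                   (MemF (Var 6) (Var 5) (Var 1) (Var 0))))))))))))))).

(** These operations suffice to compute the code of a fixed formula after numerals of computed
    numbers are substituted in it, see [code_subst]. *)
Inductive cexp : Type :=
  | CX
  | CConst (n : nat)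
  | CPair (e f : cexp)
  | CNum (e : cexp).

Fixpoint ceval (e : cexp) (x : nat) : nat :=
  match e with
  | CX => x
  | CConst n => n
  | CPair e f => Cantor.to_nat (ceval e x, ceval f x)
  | CNum e => numcode (ceval e x)
  end.

Fixpoint GraphF (e : cexp) (x y v : term) : formula :=
  match e with
  | CX => Eq y x
  | CConst n => Eq y (numeral n)
  | CPair e f =>
      BEx v (BEx (shift_term v)
        (And (GraphF e (sh2 x) (Var 1) (sh2 v))
        (And (GraphF f (sh2 x) (Var 0) (sh2 v)) (PairF (Var 1) (Var 0) (sh2 y)))))
  | CNum e =>
      BEx v (And (GraphF e (shift_term x) (Var 0) (shift_term v))
                 (NumF (Var 0) (shift_term y) (shift_term v)))
  end.

Arguments Cantor.to_nat : simpl never.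
Arguments numcode : simpl never.

Lemma Delta0_GraphF e : forall x y v, Delta0 (GraphF e x y v).
Proof.
  induction e; intros x y v; cbn [GraphF]; unfold NumF, MemF, PairF, BEx, BAll;
    repeat first [apply IHe | apply IHe1 | apply IHe2 | constructor].
Qed.

Lemma subst_BEx s t p : subst s (BEx t p) = BEx (subst_term s t) (subst (up s) p).
Proof. cbn; now rewrite up_shift. Qed.

Lemma subst_BAll s t p : subst s (BAll t p) = BAll (subst_term s t) (subst (up s) p).
Proof. cbn; now rewrite up_shift. Qed.

Lemma subst_MemF s b c i z :
  subst s (MemF b c i z) =
  MemF (subst_term s b) (subst_term s c) (subst_term s i) (subst_term s z).
Proof. unfold MemF; rewrite subst_BEx; cbn; now rewrite !up_shift. Qed.

Lemma subst_NumF s a y v :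
  subst s (NumF a y v) = NumF (subst_term s a) (subst_term s y) (subst_term s v).
Proof.
  unfold NumF, PairF, sh3, sh2.
  repeat (rewrite ?subst_BEx, ?subst_BAll, ?subst_MemF, ?up_shift; cbn [subst]).
  cbn [subst_term DpairT]; rewrite ?up_shift, ?subst_numeral; reflexivity.
Qed.

Lemma subst_GraphF e : forall s x y v,
  subst s (GraphF e x y v) =
  GraphF e (subst_term s x) (subst_term s y) (subst_term s v).
Proof.
  induction e; intros s x y v; cbn [GraphF]; unfold sh2; rewrite ?subst_BEx;
    cbn [subst].
  - reflexivity.
  - now rewrite subst_numeral.
  - rewrite IHe1, IHe2, !up_shift.
    cbn; now rewrite !up_shift.
  - now rewrite IHe, subst_NumF, !up_shift.
Qed.

(** * Correctness of the graph formulas in the standard model *)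

Lemma sat_MemF r b c i z :
  sat r (MemF b c i z) <-> mem (teval r b) (teval r c) (teval r i) (teval r z).
Proof.
  unfold mem, dpair; cbn; setoid_rewrite teval_shift; reflexivity.
Qed.

Lemma sat_PairF r a b p :
  sat r (PairF a b p) <-> teval r p = Cantor.to_nat (teval r a, teval r b).
Proof.
  pose proof (dpair_to_nat (teval r a) (teval r b)) as H; unfold dpair in H.
  cbn; rewrite H; lia.
Qed.

Lemma sat_BEx r t p :
  sat r (BEx t p) <-> exists a, a <= teval r t /\ sat (scons a r) p.
Proof. cbn; setoid_rewrite teval_shift; reflexivity. Qed.

Lemma sat_BAll r t p :
  sat r (BAll t p) <-> forall a, a <= teval r t -> sat (scons a r) p.
Proof. cbn; setoid_rewrite teval_shift; reflexivity. Qed.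

Definition num_witness (a y v : nat) : Prop :=
  exists b, b <= v /\ exists c, c <= v /\ exists N, N <= v /\
  a <= N /\ y <= N /\ mem b c a y /\
  forall i, i <= N -> forall z, z <= N -> mem b c i z ->
    (i = 0 /\ z = numcode 0) \/
    exists i', i' <= i /\ exists z', z' <= z /\
      i = S i' /\ z = Cantor.to_nat (2, z') /\ mem b c i' z'.

Lemma sat_NumF r a y v :
  sat r (NumF a y v) <-> num_witness (teval r a) (teval r y) (teval r v).
Proof.
  unfold NumF, num_witness, sh3, sh2.
  repeat (setoid_rewrite sat_MemF || setoid_rewrite sat_PairF
          || (progress cbn [sat]) || setoid_rewrite sat_BAll || setoid_rewrite sat_BEx).
  repeat setoid_rewrite teval_shift; cbn [teval scons].
  repeat setoid_rewrite teval_numeral. reflexivity.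
Qed.

Lemma num_witness_mono a y v v' :
  v <= v' -> num_witness a y v -> num_witness a y v'.
Proof.
  intros L (b & Hb & c & Hc & N & HN & H).
  exists b; split; [lia|]; exists c; split; [lia|]; exists N; split; [lia|exact H].
Qed.

(** Descent along [a]: every member within [N] is the base pair or is justified by a member for the
    predecessor, so extra elements of the coded set do no harm. *)
Lemma num_witness_sound a y v : num_witness a y v -> y = numcode a.
Proof.
  intros (b & _ & c & _ & N & _ & Ha & Hy & Hm & H).
  revert y Hy Hm; induction a as [|a IH]; intros y Hy Hm;
    destruct (H _ Ha _ Hy Hm) as [[Ea Ey]|(i & _ & z & Hz & Ea & Ey & M)];
    try discriminate Ea; auto.
  injection Ea as <-; rewrite (IH ltac:(lia) z ltac:(lia) M) in Ey; exact Ey.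
Qed.

Lemma num_witness_complete a : exists v, num_witness a (numcode a) v.
Proof.
  destruct (numcode_set a) as (N & b & c & H).
  destruct (H 0 0 (Nat.le_0_l N) (Nat.le_0_l N)) as (_ & Ha & Hj).
  exists (b + c + N).
  exists b; split; [lia|]; exists c; split; [lia|]; exists N; split; [lia|].
  split; [exact Ha|]; split; [now apply Hj|]; split.
  { apply H; auto. }
  intros i Hi z Hz M; apply H in M; auto; destruct M as [Li ->].
  destruct i as [|i]; [now left|right].
  assert (E : numcode (S i) = Cantor.to_nat (2, numcode i)) by reflexivity.
  (* The justifying value must be bounded by the value it justifies, and pairing does not decrease
     its second component. *)
  pose proof (Cantor.to_nat_non_decreasing 2 (numcode i)).
  exists i; split; [lia|]; exists (numcode i); split; [lia|].
  repeat split; auto; apply H; [lia|apply Hj; lia|split; [lia|auto]].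
Qed.

Lemma sat_GraphF_sound e : forall r x y v,
  sat r (GraphF e x y v) -> teval r y = ceval e (teval r x).
Proof.
  induction e; intros r x y v; cbn [GraphF ceval]; unfold sh2.
  - auto.
  - cbn; now rewrite teval_numeral.
  - rewrite sat_BEx; intros (a & _ & H); rewrite sat_BEx in H.
    destruct H as (b & _ & H1 & H2 & H3).
    apply IHe1 in H1; apply IHe2 in H2; apply sat_PairF in H3.
    rewrite !teval_shift in *; cbn in *; congruence.
  - rewrite sat_BEx; intros (a & _ & H1 & H2).
    apply IHe in H1; apply sat_NumF, num_witness_sound in H2.
    rewrite !teval_shift in *; cbn in *; congruence.
Qed.

(** Stated for every large [v], because the parts of a compound expression must share a single
    bound. *)
Lemma sat_GraphF_complete e : forall r x y,
  teval r y = ceval e (teval r x) ->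
  exists n, forall v, n <= teval r v -> sat r (GraphF e x y v).
Proof.
  induction e; intros r x y E; cbn [GraphF ceval] in *; unfold sh2.
  - exists 0; auto.
  - exists 0; cbn; now rewrite teval_numeral.
  - set (a := ceval e1 (teval r x)) in *; set (b := ceval e2 (teval r x)) in *.
    destruct (IHe1 (scons b (scons a r)) (shift_term (shift_term x)) (Var 1))
      as (n1 & H1); [now rewrite !teval_shift|].
    destruct (IHe2 (scons b (scons a r)) (shift_term (shift_term x)) (Var 0))
      as (n2 & H2); [now rewrite !teval_shift|].
    exists (n1 + n2 + a + b); intros v Hv.
    apply sat_BEx; exists a; split; [lia|].
    apply sat_BEx; exists b; rewrite teval_shift; split; [lia|].
    split; [apply H1|split; [apply H2|apply sat_PairF]];
      rewrite !teval_shift; auto; lia.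
  - set (a := ceval e (teval r x)) in *.
    destruct (IHe (scons a r) (shift_term x) (Var 0)) as (n1 & H1);
      [now rewrite !teval_shift|].
    destruct (num_witness_complete a) as (n2 & H2).
    exists (n1 + n2 + a); intros v Hv.
    apply sat_BEx; exists a; split; [lia|].
    split; [apply H1|apply sat_NumF]; rewrite !teval_shift; [lia|].
    rewrite E; apply num_witness_mono with n2; [lia|exact H2].
Qed.

(* The last conjunct makes the relation functional inside the theory, not just
   in the standard model. *)
Definition UGraphF (e : cexp) (x y v : term) : formula :=
  And (GraphF e x y v) (And (Le y v)
    (BAll v (BAll (Var 0)
      (Imp (GraphF e (sh2 x) (Var 0) (Var 1)) (Eq (Var 0) (sh2 y)))))).

Lemma Delta0_UGraphF e x y v : Delta0 (UGraphF e x y v).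
Proof.
  unfold UGraphF, BAll; repeat (apply Delta0_GraphF || constructor).
Qed.

Lemma subst_UGraphF e s x y v :
  subst s (UGraphF e x y v) =
  UGraphF e (subst_term s x) (subst_term s y) (subst_term s v).
Proof.
  unfold UGraphF, sh2; cbn [subst].
  rewrite !subst_BAll; cbn [subst]; rewrite !subst_GraphF.
  cbn; now rewrite !up_shift.
Qed.

(** * Existence and uniqueness of values inside the theory, and fixed points *)

Lemma prv_GraphF_numeral T e m j i :
  PA_ext T ->
  (j = ceval e m /\
   forall G, prv T G (GraphF e (numeral m) (numeral j) (numeral i))) \/
  (forall G, prv T G (Neg (GraphF e (numeral m) (numeral j) (numeral i)))).
Proof.
  intros E.
  (* All arguments are numerals, so any assignment with its matching substitution will do; zero is
     chosen. *)
  pose proof (prv_Delta0 T _ E (Delta0_GraphF e (numeral m) (numeral j) (numeral i))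
    (fun _ => 0) (fun _ => Zero) (fun _ => eq_refl)) as H.
  rewrite subst_GraphF, !subst_numeral in H.
  destruct H as [[H K]|[_ K]]; [left|right; exact K]; split; auto.
  apply sat_GraphF_sound in H; now rewrite !teval_numeral in H.
Qed.

Lemma prv_UGraphF_exists T e m :
  PA_ext T ->
  exists v, forall G,
    prv T G (UGraphF e (numeral m) (numeral (ceval e m)) (numeral v)).
Proof.
  intros E.
  destruct (sat_GraphF_complete e (fun _ => 0) (numeral m) (numeral (ceval e m)))
    as (n & Hn); [now rewrite !teval_numeral|].
  (* The summand [n] makes the graph formula true, the other one bounds the value; the uniqueness
     clause follows from soundness. *)
  pose (v := n + ceval e m); exists v.
  pose proof (prv_Delta0 T _ E (Delta0_UGraphF e (numeral m) (numeral (ceval e m))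
    (numeral v)) (fun _ => 0) (fun _ => Zero) (fun _ => eq_refl)) as H.
  rewrite subst_UGraphF, !subst_numeral in H.
  destruct H as [[_ K]|[N _]]; [exact K|exfalso; apply N].
  split; [apply Hn|split]; cbn [sat]; rewrite ?teval_numeral; [lia|lia|].
  apply sat_BAll; intros i _; apply sat_BAll; intros j _ H.
  apply sat_GraphF_sound in H; unfold sh2 in *; cbn in *.
  now rewrite !teval_shift, !teval_numeral in *.
Qed.

(** Since [v] may be nonstandard, it is compared with a standard bound [n] for the true value. If v
    <= n, both [v] and [y] are numerals and the graph formula is decided. If n <= v, the last clause
    of [UGraphF], applied to the bound [n] and the true value, yields equality with [y]. *)
Lemma prv_UGraphF_unique T G e m y v :
  PA_ext T -> prv T G (UGraphF e (numeral m) y v) ->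
  prv T G (Eq y (numeral (ceval e m))).
Proof.
  intros E H.
  assert (W : forall q H', prv T H' q -> forall p, prv T (p :: H') q)
    by (intros; eapply prv_weaken; eauto; intros x; simpl; tauto).
  destruct (prv_UGraphF_exists T e m E) as (n & Hn).
  eapply prv_orE; [apply (prv_le_numeral_total T G v n E)| |].
  - apply prv_le_numeral_cases with (t := v) (n := n); auto;
      [apply prv_hyp; now left|].
    intros i _; set (G1 := _ :: _ :: G).
    assert (Hv : prv T G1 (Eq v (numeral i))) by (apply prv_hyp; now left).
    assert (H1 : prv T G1 (UGraphF e (numeral m) y v)) by (apply W, W, H).
    apply prv_le_numeral_cases with (t := y) (n := i); auto.
    { eapply prv_le_eq; [apply prv_eq_refl|exact Hv|].
      eapply prv_andE1, prv_andE2, H1. }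
    intros j _; set (G2 := _ :: G1).
    assert (Hy : prv T G2 (Eq y (numeral j))) by (apply prv_hyp; now left).
    destruct (prv_GraphF_numeral T e m j i E) as [[<- _]|N]; [exact Hy|].
    apply prv_botE; eapply prv_impE; [apply N|].
    pose proof (prv_eq_subst T G2 y (numeral j) (fun _ => numeral i)
      (GraphF e (numeral m) (Var 0) (Var 1)) Hy) as R1.
    pose proof (prv_eq_subst T G2 v (numeral i) (fun _ => y)
      (GraphF e (numeral m) (Var 1) (Var 0)) (W _ _ Hv _)) as R2.
    rewrite !subst_GraphF, !subst_numeral in R1, R2; cbn in R1, R2.
    apply R1, R2, W; eapply prv_andE1, H1.
  - set (G1 := _ :: G); apply prv_eq_sym.
    assert (A : prv T G1 (Imp (GraphF e (numeral m) (numeral (ceval e m)) (numeral n))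
                  (Eq (numeral (ceval e m)) y))).
    { assert (K := prv_andE2 _ _ _ _ (prv_andE2 _ _ _ _ (W _ _ H _)) : prv T G1 _).
      apply (prv_allE _ _ _ (numeral n)) in K; unfold inst in K; cbn [subst] in K.
      rewrite subst_BAll in K; cbn [subst] in K; rewrite subst_GraphF in K.
      unshelve epose proof (K' := prv_impE _ _ _ _ K _);
        [cbn; rewrite inst_shift_term; apply prv_hyp; now left|clear K].
      apply (prv_allE _ _ _ (numeral (ceval e m))) in K'; unfold inst in K'.
      cbn [subst] in K'; rewrite subst_GraphF in K'.
      unshelve epose proof (K := prv_impE _ _ _ _ K' _);
        [cbn; rewrite shift_numeral, subst_numeral; eapply prv_andE1, prv_andE2, Hn|].
      unfold sh2 in K; cbn in K; rewrite !up_shift, !inst_shift_term in K.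
      rewrite ?shift_numeral, ?subst_numeral in K; exact K. }
    eapply prv_impE; [exact A|]; eapply prv_andE1, Hn.
Qed.

(* Naming the argument by a quantifier instead of substituting it makes the code
   of the result a composition of pairings of the code of [theta] and the code of
   its numeral, so substitution need not be arithmetized. *)
Definition self_apply (theta : formula) : formula :=
  Ex (And (Eq (Var 0) (numeral (code theta))) theta).

(** [theta] says of its argument that [q] holds at the value of [e] there; the argument appears as
    [Var 2] below two quantifiers. Uniqueness of the value gives one direction, existence the
    other. *)
Lemma diagonal T q e :
  PA_ext T -> below 1 q -> exists theta,
    proves T (Iff (self_apply theta) (inst (numeral (ceval e (code theta))) q)).
Proof.
  intros E B.
  pose (theta := Ex (Ex (And (UGraphF e (Var 2) (Var 1) (Var 0)) (inst (Var 1) q)))).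
  exists theta; set (m := code theta); set (n := ceval e m).
  assert (Q : forall s t, subst s (inst t q) = inst (subst_term s t) q).
  { intros s t; unfold inst; rewrite subst_comp; apply subst_below with (1 := B).
    intros [|i] Hi; [reflexivity|lia]. }
  assert (R : forall G t u, prv T G (Eq t u) -> prv T G (inst t q) -> prv T G (inst u q)).
  { intros G t u H K; apply (prv_eq_subst T G t u Var q H) in K; exact K. }
  change (prv T [] (Iff (self_apply theta) (inst (numeral n) q))).
  apply prv_andI; apply prv_impI.
  - eapply prv_exE; [apply E|apply prv_hyp; now left|].
    eapply prv_exE; [apply E|eapply prv_andE2, prv_hyp; now left|].
    eapply prv_exE; [apply E|apply prv_hyp; now left|].
    unfold shift; rewrite !Q, !subst_numeral.
    set (G := _ :: _).
    (* The equation introduced by [self_apply] has been shifted by the two eliminations that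
       followed it. *)
    assert (Hx : prv T G (Eq (Var 2) (numeral m))).
    { assert (K : prv T G (shift (shift (And (Eq (Var 0) (numeral m)) theta))))
        by (apply prv_hyp; right; right; now left).
      apply prv_andE1 in K; cbn [shift subst subst_term] in K.
      now rewrite !subst_numeral in K. }
    assert (HU : prv T G (UGraphF e (Var 2) (Var 1) (Var 0)))
      by (eapply prv_andE1, prv_hyp; now left).
    apply R with (Var 1); [|eapply prv_andE2, prv_hyp; now left].
    apply prv_UGraphF_unique with (v := Var 0); auto.
    pose proof (prv_eq_subst T G (Var 2) (numeral m) (scons (Var 1) (fun _ => Var 0))
      (UGraphF e (Var 0) (Var 1) (Var 2)) Hx) as K.
    rewrite !subst_UGraphF in K; exact (K HU).
  - destruct (prv_UGraphF_exists T e m E) as (v & Hv).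
    apply (prv_exI _ _ _ (numeral m)); unfold inst at 2; cbn [subst].
    apply prv_andI; [cbn; fold m; rewrite subst_numeral; apply prv_eq_refl|].
    unfold theta; cbn [subst].
    apply (prv_exI _ _ _ (numeral n)); unfold inst at 2; cbn [subst].
    apply (prv_exI _ _ _ (numeral v)); unfold inst at 2; cbn [subst].
    rewrite !subst_UGraphF, !Q; cbn.
    rewrite ?subst_numeral, ?shift_numeral, ?subst_numeral.
    apply prv_andI; [apply Hv|apply prv_hyp; now left].
Qed.

(** * Codes of substitution instances and of iterated provability statements *)

Definition code_definable (s : nat -> nat -> term) : Prop :=
  forall i, (exists t, forall x, s x i = t) \/
            (exists e, forall x, s x i = numeral (ceval e x)).

Lemma code_definable_up s : code_definable s -> code_definable (fun x => up (s x)).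
Proof.
  intros H [|i]; cbn; [left; eauto|].
  destruct (H i) as [(t & K)|(e & K)]; [left; exists (shift_term t)|right; exists e];
    intros x; rewrite K; auto using shift_numeral.
Qed.

Lemma code_subst_term s t : code_definable s ->
  exists e, forall x, code_term (subst_term (s x) t) = ceval e x.
Proof.
  intros H; induction t as [i| |t (e & IH)|t (e & IH) u (f & IH')
    |t (e & IH) u (f & IH')].
  - destruct (H i) as [(t & K)|(e & K)].
    + exists (CConst (code_term t)); intros x; cbn; now rewrite K.
    + exists (CNum e); intros x; cbn; now rewrite K.
  - exists (CConst (code_term Zero)); reflexivity.
  - exists (CPair (CConst 2) e); intros x; cbn; now rewrite IH.
  - exists (CPair (CConst 3) (CPair e f)); intros x; cbn; now rewrite IH, IH'.
  - exists (CPair (CConst 4) (CPair e f)); intros x; cbn; now rewrite IH, IH'.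
Qed.

(** Each syntactic constructor pairs a constant tag with the codes of its parts, and [x] enters only
    through numerals, which binders leave unchanged. *)
Lemma code_subst p : forall s, code_definable s ->
  exists e, forall x, code (subst (s x) p) = ceval e x.
Proof.
  induction p as [t u|t u| |p IHp q IHq|p IHp q IHq|p IHp q IHq|p IHp|p IHp];
    intros s H;
    try (destruct (code_subst_term s t H) as (e & He);
         destruct (code_subst_term s u H) as (f & Hf));
    try (destruct (IHp s H) as (e & He); destruct (IHq s H) as (f & Hf));
    try (destruct (IHp _ (code_definable_up s H)) as (e & He)).
  - exists (CPair (CConst 0) (CPair e f)); intros x; cbn; now rewrite He, Hf.
  - exists (CPair (CConst 1) (CPair e f)); intros x; cbn; now rewrite He, Hf.
  - exists (CConst (code Bot)); reflexivity.
  - exists (CPair (CConst 3) (CPair e f)); intros x; cbn; now rewrite He, Hf.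
  - exists (CPair (CConst 4) (CPair e f)); intros x; cbn; now rewrite He, Hf.
  - exists (CPair (CConst 5) (CPair e f)); intros x; cbn; now rewrite He, Hf.
  - exists (CPair (CConst 6) e); intros x; cbn; now rewrite He.
  - exists (CPair (CConst 7) e); intros x; cbn; now rewrite He.
Qed.

(** One more application of [pr] instantiates the fixed formula [Pr] at the numeral of the previous
    code, so [code_subst] supplies the next expression. *)
Lemma code_pr_iter Pr j e : exists f, forall x p,
  code p = ceval e x -> code (pr_iter Pr j p) = ceval f x.
Proof.
  induction j as [|j (f & IH)]; [now exists e|].
  destruct (code_subst Pr (fun x i => match i with
              | O => numeral (ceval f x) | S i => Var i end)) as (g & Hg).
  { intros [|i]; [right|left]; eauto. }
  exists g; intros x p Hp; cbn; unfold pr, inst, quote; now rewrite (IH x p Hp).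
Qed.

Lemma pr_iter_fixed_point T Pr j :
  PA_ext T -> below 1 Pr ->
  exists X, proves T (Iff X (Neg (pr_iter Pr (S j) X))).
Proof.
  intros E B.
  (* This [e] sends the code of [theta] to the code of [self_apply theta]: the tags 7, 4 and 0 are
     those of [Ex], [And] and [Eq]. *)
  pose (e := CPair (CConst 7) (CPair (CConst 4) (CPair
    (CPair (CConst 0) (CPair (CConst (code_term (Var 0))) (CNum CX))) CX))).
  destruct (code_pr_iter Pr j e) as (f & Hf).
  destruct (diagonal T (Neg Pr) f E) as (theta & H); [cbn; auto|].
  exists (self_apply theta).
  rewrite <- (Hf _ (self_apply theta) eq_refl) in H; exact H.
Qed.

(** * Iterated provability and the contradiction with Rosser's condition *)

Lemma pr_iter_add Pr i j p : pr_iter Pr i (pr_iter Pr j p) = pr_iter Pr (i + j) p.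
Proof. induction i; cbn; congruence. Qed.

Lemma proves_impE T p q : proves T (Imp p q) -> proves T p -> proves T q.
Proof. exact (prv_impE T [] p q). Qed.

Lemma proves_imp_trans T p q r :
  proves T (Imp p q) -> proves T (Imp q r) -> proves T (Imp p r).
Proof.
  intros H K; apply (prv_impI T []).
  eapply prv_impE; [apply prv_proves, K|].
  eapply prv_impE; [apply prv_proves, H|apply prv_hyp; now left].
Qed.

Theorem theorem2p11 (S T : theory)
    (hS : consistent_ce_extension_of_PA S)
    (hT : consistent_ce_extension_of_PA T)
    (hST : extends T S)
    (n k : nat) (hn : 1 <= n) (hk : 1 <= k)
    (Pr : formula)
    (hSigma1 : Sigma1 Pr)
    (hPr : provability_predicate S T Pr)
    (hC : cond_C S Pr)
    (hD3 : cond_D3 S Pr n (n + k)) :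
  ~ cond_Ros T Pr.
Proof.
  intros ros.
  destruct hT as (T_closed & _ & T_PA & T_consistent).
  destruct hPr as [Pr_below Pr_spec].
  assert (D3_iter : forall j p,
    proves T (Imp (pr_iter Pr n p) (pr_iter Pr (n + j * k) p))).
  { intros j p; induction j as [|j IH]; cbn.
    - rewrite Nat.add_0_r; apply (prv_impI T []), prv_hyp; now left.
    (* The added implication is [hD3] for the formula [pr_iter Pr (j * k) p]. *)
    - apply proves_imp_trans with (1 := IH), hST.
      rewrite <- pr_iter_add, Nat.add_assoc, <- pr_iter_add; apply hD3. }
  assert (refute_and : forall i p q, proves T (Neg (And p q)) ->
    proves T (Neg (And (pr_iter Pr i p) (pr_iter Pr i q)))).
  { intros i p q H; induction i as [|i IH]; cbn; auto.
    eapply proves_imp_trans, ros, IH; apply hST, hC. }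
  assert (refute : forall i p, proves T (Neg p) -> proves T (Neg (pr_iter Pr i p))).
  { intros i p H; induction i as [|i IH]; cbn; auto. }
  assert (necessitation : forall i p, proves T p -> proves T (pr_iter Pr i p)).
  { intros i p H; induction i as [|i IH]; cbn; auto; apply hST, Pr_spec, IH. }
  (* [D3_iter] lets us take a multiple of [k] that is at least [n]. *)
  destruct (n * k) as [|j] eqn:Ej; [nia|].
  destruct (pr_iter_fixed_point T Pr j) as (X & HX); [now split|exact Pr_below|].
  assert (XI := prv_andE1 T [] _ _ HX); assert (XE := prv_andE2 T [] _ _ HX).
  assert (N : proves T (Neg (pr_iter Pr n X))).
  { apply (prv_impI T []); eapply prv_impE.
    - apply prv_proves, (refute_and n X (pr_iter Pr (Datatypes.S j) X)).
      (* By the fixed point, [X] contradicts its own K-fold provability, where K = n * k. *)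
      apply (prv_impI T []); eapply prv_impE; [eapply prv_impE|].
      + apply prv_proves, XI.
      + eapply prv_andE1, prv_hyp; now left.
      + eapply prv_andE2, prv_hyp; now left.
    - apply prv_andI; [apply prv_hyp; now left|].
      eapply prv_impE; [|apply prv_hyp; now left].
      (* The second conjunct has n + n * k iterations, so it follows from the first by [D3_iter]
         with n copies of k. *)
      rewrite pr_iter_add, <- Ej; apply prv_proves, D3_iter. }
  (* K - n further applications of [ros] turn the refutation of n-fold provability into one of
     K-fold provability; K >= n because k >= 1. *)
  apply (refute (Datatypes.S j - n)) in N; rewrite pr_iter_add in N.
  replace (Datatypes.S j - n + n) with (Datatypes.S j) in N by nia.
  apply T_consistent, (proves_impE T (pr_iter Pr (Datatypes.S j) X)); auto.
  apply necessitation, (proves_impE T _ _ XE N).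
Qed.
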